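(* Let $G=(V,E)$ be a finite undirected graph with $n=|V|$ vertices and maximum degree $\Delta$, carrying a binary pairwise Markov random field with potential functions $\psi_v$ ($v\in V$), $\psi_{u,v}$ ($(u,v)\in E$) satisfying $|\psi|<\infty$, and let $\varepsilon\in(0,1)$. Then Algorithm A (defined in the context), run with parameter $\varepsilon$, terminates (i.e. reaches an iteration whose messages form an $\varepsilon$-approximate BP fixed-point) in $$(|\psi|+2)^{O(\Delta)}\, n^2\, \varepsilon^{-4}\,\log^3 (n\varepsilon^{-1})$$ iterations.
   Context: **Graphical model.** $G=(V,E)$ is a finite undirected graph with edges being unordered pairs of distinct vertices; $n=|V|$; $\mathcal N(v)$ is the set of neighbors of $v$; $\Delta=\max_v|\mathcal N(v)|$. The potentials are non-negative functions $\psi_v:\{0,1\}\to[0,\infty)$, $v\in V$, and $\psi_{u,v}:\{0,1\}^2\to[0,\infty)$, $(u,v)\in E$, defining the distribution $p(x)\propto\prod_{v}\psi_v(x_v)\prod_{(u,v)\in E}\psi_{u,v}(x_u,x_v)$ on $\{0,1\}^n$. Since edges are unordered, $\psi_{v,u}(x_v,x_u)=\psi_{u,v}(x_u,x_v)$. Define $$|\psi|:=\max\left\{e^{|\ln\psi_v(x_v)|},\,e^{|\ln\psi_{u,v}(x_u,x_v)|}\;:\;v\in V,\ (u,v)\in E,\ x_u,x_v\in\{0,1\}\right\};$$ $|\psi|<\infty$ means all potentials are strictly positive. Define $$\Psi^{(v)}:=\ln\frac{\psi_v(1)}{\psi_v(0)}+\sum_{u\in\mathcal N(v)}\ln\frac{\psi_{u,v}(0,1)}{\psi_{u,v}(0,0)},\qquad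 \Psi^{(u,v)}:=\ln\frac{\psi_{u,v}(0,0)\,\psi_{u,v}(1,1)}{\psi_{u,v}(1,0)\,\psi_{u,v}(0,1)}.$$ **Approximate BP fixed-points.** For each ordered pair of adjacent vertices $u,v$ let $$f_{u\to v}(x):=\frac{\psi_{u,v}(0,1)\psi_u(0)+\psi_{u,v}(1,1)\psi_u(1)\,x}{\psi_{u,v}(0,0)\psi_u(0)+\psi_{u,v}(1,0)\psi_u(1)\,x},\qquad x>0 .$$ A set of positive messages $\{m_{u\to v},m_{v\to u}:(u,v)\in E\}$ is an $\varepsilon$-approximate BP fixed-point if for every ordered pair of adjacent vertices $u,v$, $$\left|\frac{m_{u\to v}}{f_{u\to v}\left(\prod_{w\in\mathcal N(u)\setminus v}m_{w\to u}\right)}-1\right|\le\varepsilon .$$ **Algorithm A** (parameter $\varepsilon\in(0,1)$). It maintains $y_V(t)=[y_v(t)\in(0,1):v\in V]$ at iterations $t=1,2,\dots$. 1. Initially $y_v(1)=1/2$ for all $v\in V$. 2. At iteration $t$, for each edge $(u,v)$, $y_{u,v}(t)>0$ is the unique solution of $$e^{\Psi^{(u,v)}}\cdot\frac{y_u(t)-y_{u,v}(t)}{1-y_u(t)-y_v(t)+y_{u,v}(t)}\cdot\frac{y_v(t)-y_{u,v}(t)}{y_{u,v}(t)}=1,\qquad y_{u,v}(t)<\min\{y_v(t),y_u(t)\},$$ and the update is $$y_v(t+1)=\left[y_v(t)+\frac1{\sqrt t}\left(\Psi^{(v)}+\ln\frac{1-y_v(t)}{y_v(t)}+\sum_{u\in\mathcal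 N(v)}\ln\left(\frac{1-y_v(t)-y_u(t)+y_{u,v}(t)}{1-y_v(t)}\cdot\frac{y_v(t)}{y_v(t)-y_{u,v}(t)}\right)\right)\right]_*,$$ where at iteration $t$ the projection is $[x]_*=x$ if $\frac{0.1}{t^{1/4}}\le x\le 1-\frac{0.1}{t^{1/4}}$, $[x]_*=\frac{0.1}{t^{1/4}}$ if $x<\frac{0.1}{t^{1/4}}$, and $[x]_*=1-\frac{0.1}{t^{1/4}}$ if $x>1-\frac{0.1}{t^{1/4}}$. 3. Compute, for every ordered pair of adjacent vertices $u,v$, $$m_{u\to v}=\frac{\psi_{u,v}(0,1)}{\psi_{u,v}(0,0)}\cdot\frac{1-y_v(t)-y_u(t)+y_{u,v}(t)}{1-y_v(t)}\cdot\frac{y_v(t)}{y_v(t)-y_{u,v}(t)} .$$ 4. Terminate if $\{m_{u\to v},m_{v\to u}\}$ is an $\varepsilon$-approximate BP fixed-point. The constant hidden in $O(\cdot)$ is absolute.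
   Formalization: The bound on the number of iterations is replaced by the maximum of 1 and the stated bound; this matters only for n ≤ 1, where the stated bound can be below 1 (n = 1, ε near 1) or undefined (n = 0) although one iteration is always performed. *)

(* Defs.v *)
From mathcomp Require Import all_boot all_order all_algebra.
From mathcomp Require Import ring lra.
From mathcomp Require Import all_classical all_reals all_analysis.

Set Implicit Arguments.
Unset Strict Implicit.
Unset Printing Implicit Defensive.

Import Order.TTheory GRing.Theory Num.Theory.

Local Open Scope classical_set_scope.
Local Open Scope ring_scope.

Record sgraph := SGraph {
  vertex :> finType;
  adj : rel vertex;
  adj_sym : symmetric adj;
  adj_irrefl : irreflexive adj }.

Arguments adj {s} u v.

Definition nbr (G : sgraph) (v : G) : {set G} := [set u | adj v u]%SET.

Definition max_degree (G : sgraph) : nat := \max_(v : G) #|nbr v|.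

(* [false] and [true] encode the states 0 and 1.  [epot u v] is only
   meaningful when u and v are adjacent; the potential of the unordered edge
   {u, v} is stored once per orientation, [epot_sym] identifying the two. *)
Record mrf (R : realType) (G : sgraph) := MRF {
  vpot : G -> bool -> R;
  epot : G -> G -> bool -> bool -> R;
  vpot_ge0 : forall v a, 0 <= vpot v a;
  epot_ge0 : forall u v a b, adj u v -> 0 <= epot u v a b;
  epot_sym : forall u v a b, adj u v -> epot v u b a = epot u v a b }.

Section BeliefPropagation.
Context {R : realType} {G : sgraph} (psi : mrf R G).

(* The extended logarithm sends 0 to -oo, so a vanishing potential makes this
   +oo; the real-valued [ln] would send 0 to 0. *)
Definition psi_norm : \bar R :=
  maxe
    (\big[maxe/-oo]_(q : G * bool) expeR `|lne (vpot psi q.1 q.2)%:E|)%E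
    (\big[maxe/-oo]_(q : (G * G) * (bool * bool) | adj q.1.1 q.1.2)
       expeR `|lne (epot psi q.1.1 q.1.2 q.2.1 q.2.2)%:E|)%E.

Definition vertex_Psi (v : G) : R :=
  ln (vpot psi v true / vpot psi v false)
  + \sum_(u in nbr v) ln (epot psi u v false true / epot psi u v false false).

Definition edge_Psi (u v : G) : R :=
  ln ((epot psi u v false false * epot psi u v true true)
      / (epot psi u v true false * epot psi u v false true)).

Definition bp_fun (u v : G) (x : R) : R :=
  (epot psi u v false true * vpot psi u false
   + epot psi u v true true * vpot psi u true * x)
  / (epot psi u v false false * vpot psi u false
     + epot psi u v true false * vpot psi u true * x).

(* [m u v] is the message from u to v. *)
Definition approx_bp_fixpoint (eps : R) (m : G -> G -> R) : Prop :=
  forall u v : G, adj u v ->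
    0 < m u v /\
    `|m u v / bp_fun u v (\prod_(w in nbr u :\ v) m w u) - 1| <= eps.

Definition edge_marginal_spec (K yu yv z : R) : Prop :=
  [/\ 0 < z, z < Num.min yv yu &
      expR K * ((yu - z) / (1 - yu - yv + z)) * ((yv - z) / z) = 1].

(* The unique solution, see [edge_marginal_ex_unique]. *)
Definition edge_marginal (K yu yv : R) : R :=
  xget 0 [set z | edge_marginal_spec K yu yv z].

Definition clip (t : nat) (x : R) : R :=
  let lo := 10^-1 / (t%:R `^ 4^-1) in
  if x < lo then lo else if x > 1 - lo then 1 - lo else x.

Definition y_edge (y : G -> R) (u v : G) : R :=
  edge_marginal (edge_Psi u v) (y u) (y v).

Definition y_update (t : nat) (y : G -> R) (v : G) : R :=
  clip t (y v + (Num.sqrt t%:R)^-1 *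
    (vertex_Psi v + ln ((1 - y v) / y v)
     + \sum_(u in nbr v)
         ln ((1 - y v - y u + y_edge y u v) / (1 - y v)
             * (y v / (y v - y_edge y u v))))).

(* Iterations are numbered from 1; the value at t = 0 is unused. *)
Fixpoint y_iter (t : nat) : G -> R :=
  match t with
  | 0 | 1 => fun=> 2^-1
  | s.+1 => y_update s (y_iter s)
  end.

Definition message (t : nat) (u v : G) : R :=
  let y := y_iter t in
  epot psi u v false true / epot psi u v false false
  * ((1 - y v - y u + y_edge y u v) / (1 - y v))
  * (y v / (y v - y_edge y u v)).

Definition terminates_at (eps : R) (T : nat) : Prop :=
  [/\ (1 <= T)%N, approx_bp_fixpoint eps (message T) &
      forall s, (1 <= s < T)%N -> ~ approx_bp_fixpoint eps (message s)].

End BeliefPropagation.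

Lemma edge_marginal_ex_unique (R : realType) (K yu yv : R) :
  0 < yu < 1 -> 0 < yv < 1 -> exists! z, edge_marginal_spec K yu yv z.
Proof.
move=> /andP[a0 a1] /andP[b0 b1]; set k := expR K.
have k0 : 0 < k by exact: expR_gt0.
have specP z : edge_marginal_spec K yu yv z <->
    [/\ 0 < z, z < yu, z < yv, 0 < 1 - yu - yv + z &
        k * ((yu - z) * (yv - z)) = z * (1 - yu - yv + z)].
  rewrite /edge_marginal_spec -/k lt_min; split.
    case=> z0 /andP[zb za] h.
    have d0 : 1 - yu - yv + z != 0.
      by apply/eqP => d0; move: h; rewrite d0 invr0 !(mulr0, mul0r); lra.
    have e : k * ((yu - z) * (yv - z)) = z * (1 - yu - yv + z).
      have zn0 : z != 0 by rewrite gt_eqF.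
      rewrite -[RHS](mul1r (z * _)) -[X in X * (z * _)]h.
      by field; rewrite d0 zn0.
    split=> //.
    have : 0 < z * (1 - yu - yv + z).
      by rewrite -e !mulr_gt0 ?subr_gt0.
    by rewrite pmulr_rgt0.
  case=> z0 za zb d0 e; split=> //; first by rewrite zb za.
  have -> : k * ((yu - z) / (1 - yu - yv + z)) * ((yv - z) / z)
      = k * ((yu - z) * (yv - z)) / (z * (1 - yu - yv + z)).
    by field; rewrite !gt_eqF.
  by rewrite e divff// mulf_neq0 ?gt_eqF.
have uniq z z' : edge_marginal_spec K yu yv z ->
    edge_marginal_spec K yu yv z' -> z < z' -> False.
  move=> /specP[z0 za zb d0 e] /specP[z0' za' zb' d0' e'] zz'.
  have : k * ((yu - z') * (yv - z')) < k * ((yu - z) * (yv - z)).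
    by rewrite ltr_pM2l// ltr_pM ?subr_ge0 ?(ltW za') ?(ltW zb')// ltrD2l ltrN2.
  rewrite e e' ltNge => /negP; apply; apply: ler_pM; lra.
pose lo := Num.max 0 (yu + yv - 1); pose hi := Num.min yu yv.
pose p : {poly R} := 'X * ((1 - yu - yv)%:P + 'X)
  - k *: ((yu%:P - 'X) * (yv%:P - 'X)).
have pE z : p.[z] = z * (1 - yu - yv + z) - k * ((yu - z) * (yv - z)).
  by rewrite /p !(hornerE, hornerZ).
have lohi : lo <= hi by rewrite /lo /hi ge_max !le_min; lra.
have plo : p.[lo] < 0.
  rewrite pE /lo; case: (leP 0 (yu + yv - 1)) => h.
    have k1 : 0 < k * ((1 - yv) * (1 - yu)) by rewrite !mulr_gt0 ?subr_gt0.
    have -> : (yu + yv - 1) * (1 - yu - yv + (yu + yv - 1))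
        - k * ((yu - (yu + yv - 1)) * (yv - (yu + yv - 1)))
        = - (k * ((1 - yv) * (1 - yu))) by ring.
    by rewrite oppr_lt0.
  have : 0 < k * (yu * yv) by rewrite !mulr_gt0.
  by rewrite !subr0 mul0r sub0r oppr_lt0.
have phi : 0 < p.[hi].
  rewrite pE /hi; case: (leP yu yv) => h.
    have : 0 < yu * (1 - yv) by rewrite mulr_gt0 ?subr_gt0.
    by rewrite subrr mul0r mulr0 subr0 (_ : 1 - _ - _ + _ = 1 - yv) //; ring.
  have : 0 < yv * (1 - yu) by rewrite mulr_gt0 ?subr_gt0.
  by rewrite subrr !mulr0 subr0 subrK.
have [|z /andP[lz zh] /rootP pz] := @poly_ivt R p lo hi lohi.
  by rewrite (ltW plo) (ltW phi).
have {}lz : lo < z.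
  by rewrite lt_neqAle lz andbT; apply/eqP => lz'; move: plo; rewrite lz' pz ltxx.
have {}zh : z < hi.
  by rewrite lt_neqAle zh andbT; apply/eqP => zh'; move: phi; rewrite -zh' pz ltxx.
have zS : edge_marginal_spec K yu yv z.
  move: lz zh pz; rewrite /lo /hi gt_max lt_min pE => /andP[z0 z1] /andP[za zb] e.
  by apply/specP; split=> //; lra.
exists z; split=> // z' zS'.
by case: (ltgtP z z') => // h; exfalso; [exact: (uniq z z')|exact: (uniq z' z)].
Qed.

(* Main.v *)
Require Import Defs.
From mathcomp Require Import all_boot all_order all_algebra.
From mathcomp Require Import ring lra zify.
From mathcomp Require Import all_classical all_reals all_analysis.
Import Order.TTheory GRing.Theory Num.Theory.
Local Open Scope ring_scope.

(* The unprojected update is gradient descent, with step 1/sqrt t, on the Bethe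
   free energy F(y) obtained by minimizing over the edge marginals.  If every
   partial derivative of F at y is at most eps/4, the messages computed from y
   form an eps-approximate fixed point.  Near 0 and 1 the entropy dominates the
   gradient and pushes y inward, so after (|psi| + 2)^O(Delta) iterations the
   projection is inactive, y stays at distance (|psi| + 2)^-O(Delta) from the
   boundary, and F is smooth at the scale of one step.  From then on a step that
   does not reach a fixed point decreases F by at least eps^2 / (32 sqrt t);
   since |F| <= n (|psi| + 2)^O(Delta), this stops after
   (|psi| + 2)^O(Delta) n^2 eps^-4 iterations, without any logarithm. *)

(** * Convexity of p ln p and the free energy of a single edge *)

Section Entropy.
Context {R : realType}.
Implicit Types p q m x y z K : R.

Lemma ln_le_sub1 x : 0 < x -> ln x <= x - 1.
Proof.
move=> x0; have := @le_ln1Dx R (x - 1).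
by rewrite (_ : 1 + (x - 1) = x); [apply; lra | ring].
Qed.

Definition xlnx p := p * ln p.

(** Convexity of p ln p, from ln x <= x - 1 at x = p/q. *)
Lemma xlnx_tangent p q : 0 < p -> 0 < q ->
  xlnx p + (1 + ln p) * (q - p) <= xlnx q.
Proof.
move=> p0 q0; rewrite /xlnx.
have := ln_le_sub1 (p / q) (divr_gt0 p0 q0); rewrite ln_div ?posrE// => h.
have : q * (ln p - ln q) <= p - q.
  have -> : p - q = q * (p / q - 1) by field; rewrite gt_eqF.
  by rewrite ler_pM2l.
lra.
Qed.

(** From ln x <= x - 1 at x = q/p. The curvature constant depends on p alone, however close q is to
    0. *)
Lemma xlnx_upper p q : 0 < p -> 0 < q ->
  xlnx q <= xlnx p + (1 + ln p) * (q - p) + (q - p) ^+ 2 / p.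
Proof.
move=> p0 q0; rewrite /xlnx.
have := ln_le_sub1 (q / p) (divr_gt0 q0 p0); rewrite ln_div ?posrE// => h.
have : q * (ln q - ln p) <= q * (q / p - 1) by rewrite ler_pM2l.
have -> : q * (q / p - 1) = (q - p) + (q - p) ^+ 2 / p by field; rewrite gt_eqF.
lra.
Qed.

Lemma xlnx_upper_bound m p q : 0 < m -> m <= p -> 0 < q ->
  xlnx q <= xlnx p + (1 + ln p) * (q - p) + (q - p) ^+ 2 / m.
Proof.
move=> m0 mp q0; have p0 : 0 < p by lra.
apply: le_trans (xlnx_upper p q p0 q0) _; rewrite lerD2l.
by apply: ler_wpM2l; rewrite ?sqr_ge0// lef_pV2.
Qed.

Lemma xlnx_itv p : 0 < p < 1 -> -1 <= xlnx p <= 0.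
Proof.
move=> /andP[p0 p1]; rewrite /xlnx.
have := xlnx_tangent 1 p ltr01 p0; rewrite /xlnx ln1 => h.
have : p * ln p <= 0 by rewrite pmulr_rle0// ln_le0// ltW.
lra.
Qed.

(** The negative of the Shannon entropy of a Bernoulli variable, hence convex. *)
Definition entropy y := xlnx y + xlnx (1 - y).

Lemma entropy_itv y : 0 < y < 1 -> -2 <= entropy y <= 0.
Proof.
move=> /andP[y0 y1]; rewrite /entropy.
have := @xlnx_itv y; have := @xlnx_itv (1 - y); lra.
Qed.

(** 1 - d is the weight of a vertex of degree [d] in the Bethe free energy. Only d = 0 uses the
    quadratic upper bound; for d >= 1 the weight is at most 0, and convexity makes the linear part
    an upper bound. *)
Lemma entropy_move (d : nat) m y y' : 0 < m -> m <= y -> m <= 1 - y ->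
  0 < y' < 1 ->
  (1 - d%:R) * entropy y' <= (1 - d%:R) * entropy y
    + (1 - d%:R) * ln (y / (1 - y)) * (y' - y) + 2 * (y' - y) ^+ 2 / m.
Proof.
move=> m0 my my' /andP[y'0 y'1]; have y0 : 0 < y by lra.
have y1 : 0 < 1 - y by lra.
rewrite ln_div ?posrE// /entropy.
have sq : 0 <= (y' - y) ^+ 2 / m by rewrite divr_ge0 ?sqr_ge0// ltW.
case: d => [|d].
  have := @xlnx_upper_bound m y y' m0 my y'0.
  have := @xlnx_upper_bound m (1 - y) (1 - y') m0 my' ltac:(lra).
  have -> : (1 - y' - (1 - y)) ^+ 2 = (y' - y) ^+ 2 by ring.
  lra.
have -> : 1 - d.+1%:R = - d%:R :> R by rewrite -natr1; ring.
have d0 : 0 <= d%:R :> R by [].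
have h : xlnx y + xlnx (1 - y) + (ln y - ln (1 - y)) * (y' - y)
   <= xlnx y' + xlnx (1 - y').
  have := @xlnx_tangent y y' y0 y'0.
  have := @xlnx_tangent (1 - y) (1 - y') y1 ltac:(lra).
  lra.
have := ler_wpM2l d0 h; lra.
Qed.

(* A pair of binary variables with marginals P(1) = x and y and P(1, 1) = z has
   the cell probabilities z, x - z, y - z and 1 - x - y + z. *)
Definition feasible x y z :=
  [/\ 0 < z, 0 < x - z, 0 < y - z & 0 < 1 - x - y + z].

(** Negative joint entropy of the pair minus the interaction K z. *)
Definition edge_energy K x y z :=
  xlnx z + xlnx (x - z) + xlnx (y - z) + xlnx (1 - x - y + z) - K * z.

(** The edge marginal equation with denominators cleared. Its logarithm says that the derivative of
    [edge_energy] in [z] vanishes. *)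
Definition stationary K x y z :=
  feasible x y z /\ z * (1 - x - y + z) = expR K * ((x - z) * (y - z)).

Lemma edge_marginal_specP K x y z :
  edge_marginal_spec K x y z -> stationary K x y z.
Proof.
rewrite /edge_marginal_spec lt_min => -[z0 /andP[zy zx] h].
(* The inverse of 0 being 0, a vanishing denominator would turn [h] into 0 = 1. *)
have d0 : 1 - x - y + z != 0.
  by apply/eqP => d0; move: h; rewrite d0 invr0 !(mulr0, mul0r); lra.
have e : z * (1 - x - y + z) = expR K * ((x - z) * (y - z)).
  have zn0 : z != 0 by rewrite gt_eqF.
  rewrite -[LHS](mul1r (z * _)) -[X in X * (z * _)]h.
  by field; rewrite d0 zn0.
split=> //; split; rewrite ?subr_gt0//.
have : 0 < z * (1 - x - y + z) by rewrite e !mulr_gt0 ?subr_gt0 ?expR_gt0.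
by rewrite pmulr_rgt0.
Qed.

Lemma stationary_ln K x y z : stationary K x y z ->
  ln z + ln (1 - x - y + z) = K + ln (x - z) + ln (y - z).
Proof.
move=> [[z0 a0 b0 d0] e].
by rewrite -lnM ?posrE// e !lnM ?posrE ?mulr_gt0 ?expR_gt0// expRK addrA.
Qed.

(** The tangent bounds of the four cells are added; their linear terms cancel by stationarity. *)
Lemma edge_energy_min K x y z z' : stationary K x y z -> feasible x y z' ->
  edge_energy K x y z <= edge_energy K x y z'.
Proof.
move=> s [z0' a0' b0' d0']; have := stationary_ln _ _ _ _ s.
case: s => -[z0 a0 b0 d0] _ e; rewrite /edge_energy.
have h1 := @xlnx_tangent _ _ z0 z0'.
have h2 := @xlnx_tangent _ _ a0 a0'.
have h3 := @xlnx_tangent _ _ b0 b0'.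
have h4 := @xlnx_tangent _ _ d0 d0'.
have : (z' - z) * (ln z + ln (1 - x - y + z)) =
       (z' - z) * (K + ln (x - z) + ln (y - z)) by rewrite e.
lra.
Qed.

(** With [z] fixed only three cells move, by a = x' - x, b = y' - y and -(a + b); the factor 3 comes
    from a^2 + b^2 + (a + b)^2 <= 3 (a^2 + b^2). *)
Lemma edge_energy_move K x y z x' y' m : 0 < m -> m <= z -> m <= x - z ->
  m <= y - z -> m <= 1 - x - y + z -> feasible x' y' z ->
  edge_energy K x' y' z <= edge_energy K x y z
    + (x' - x) * ln ((x - z) / (1 - x - y + z))
    + (y' - y) * ln ((y - z) / (1 - x - y + z))
    + 3 * ((x' - x) ^+ 2 + (y' - y) ^+ 2) / m.
Proof.
move=> m0 mz ma mb md [_ a0' b0' d0'].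
rewrite !ln_div ?posrE; try lra; rewrite /edge_energy.
have h2 := @xlnx_upper_bound _ _ _ m0 ma a0'.
have h3 := @xlnx_upper_bound _ _ _ m0 mb b0'.
have h4 := @xlnx_upper_bound _ _ _ m0 md d0'.
have : (x' - z - (x - z)) ^+ 2 / m + (y' - z - (y - z)) ^+ 2 / m +
   (1 - x' - y' + z - (1 - x - y + z)) ^+ 2 / m <=
   3 * ((x' - x) ^+ 2 + (y' - y) ^+ 2) / m.
  rewrite -!mulrDl; apply: ler_wpM2r; first by rewrite invr_ge0 ltW.
  have := sqr_ge0 ((x' - x) - (y' - y)); lra.
lra.
Qed.

Lemma edge_energy_itv K x y z : x < 1 -> y < 1 -> feasible x y z ->
  `|edge_energy K x y z| <= 4 + `|K|.
Proof.
move=> x1 y1 [z0 a0 b0 d0]; rewrite /edge_energy.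
have := @xlnx_itv z; have := @xlnx_itv (x - z); have := @xlnx_itv (y - z).
have := @xlnx_itv (1 - x - y + z).
have : `|K * z| <= `|K|.
  by rewrite normrM -{2}(mulr1 `|K|) ler_wpM2l// gtr0_norm//; lra.
rewrite !ler_norml; lra.
Qed.

(** Here [a] is a cell of a two-by-two table, [b] and [c] its neighbours, [d] the opposite cell.
    Either a >= dl/2, or [b] and [c] both exceed dl/2 and a >= a d >= k b c. *)
Lemma cell_lower (k dl a b c d : R) : 0 < k -> k <= 1 -> 0 <= dl -> dl <= 1 ->
  0 < a -> 0 < b -> 0 < c -> d <= 1 -> dl <= a + b -> dl <= a + c ->
  k * (b * c) <= a * d -> k * (dl ^+ 2 / 4) <= a.
Proof.
move=> k0 k1 dl0 dl1 a0 b0 c0 d1 ab ac h.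
case: (leP (dl / 2) a) => ha.
  have : k * (dl ^+ 2 / 4) <= 1 * (dl / 2).
    by rewrite ler_pM ?divr_ge0 ?sqr_ge0 ?(ltW k0)//; nra.
  lra.
have : (dl / 2) * (dl / 2) <= b * c by rewrite ler_pM; lra.
move=> /(ler_wpM2l (ltW k0)) => h2.
have : a * d <= a by rewrite ger_pMr.
lra.
Qed.

Lemma expR_norm_itv K : expR (- `|K|) <= expR K <= expR `|K|.
Proof. by rewrite !ler_expR lerNl -normrN ler_norm normrN ler_norm. Qed.

Lemma stationary_cells K x y z dl : stationary K x y z ->
  0 < dl -> dl <= x -> dl <= 1 - x -> dl <= y -> dl <= 1 - y ->
  let m := expR (- `|K|) * (dl ^+ 2 / 4) in
  [/\ m <= z, m <= x - z, m <= y - z & m <= 1 - x - y + z].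
Proof.
move=> [[z0 a0 b0 d0] e] dl0 xl xu yl yu /=.
have k0 := expR_gt0 (- `|K|).
have k1 : expR (- `|K|) <= 1 by rewrite expR_le1 oppr_le0.
have /andP[kl ku] := expR_norm_itv K.
have kk : expR (- `|K|) * expR K <= 1 by rewrite -expRD expR_le1 addrC subr_le0 ler_norm.
have ab0 : 0 <= (x - z) * (y - z) by rewrite mulr_ge0 ?ltW.
split.
- apply: (@cell_lower _ _ _ (x - z) (y - z) (1 - x - y + z)) => //;
    try by clear -z0 a0 b0 d0 dl0 xl xu yl yu; lra.
  by rewrite e ler_wpM2r.
- apply: (@cell_lower _ _ _ z (1 - x - y + z) (y - z)) => //;
    try by clear -z0 a0 b0 d0 dl0 xl xu yl yu; lra.
  by rewrite e mulrA ler_piMl.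
- apply: (@cell_lower _ _ _ z (1 - x - y + z) (x - z)) => //;
    try by clear -z0 a0 b0 d0 dl0 xl xu yl yu; lra.
  by rewrite e mulrA [leRHS]mulrC ler_piMl.
- apply: (@cell_lower _ _ _ (x - z) (y - z) z) => //;
    try by clear -z0 a0 b0 d0 dl0 xl xu yl yu; lra.
  by rewrite [leRHS]mulrC e ler_wpM2r.
Qed.

(** By stationarity the ratio is a weighted average of 1 and e^K, with weights proportional to 1 - x
    - y + z and x - z. *)
Lemma stationary_ratio K x y z : stationary K x y z ->
  0 < (1 - y - x + z) / (1 - y) * (y / (y - z)) /\
  `|ln ((1 - y - x + z) / (1 - y) * (y / (y - z)))| <= `|K|.
Proof.
move=> [[z0 a0 b0 d0] e].
have -> : (1 - y - x + z) / (1 - y) * (y / (y - z)) =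
   ((1 - x - y + z) + expR K * (x - z)) / ((1 - x - y + z) + (x - z)).
  have n1 : y - z != 0 by rewrite gt_eqF.
  have n2 : 1 - y != 0 by rewrite gt_eqF//; lra.
  rewrite (_ : 1 - y - x + z = 1 - x - y + z); last by ring.
  rewrite (_ : 1 - x - y + z + (x - z) = 1 - y); last by ring.
  rewrite mulrAC; congr (_ / _).
  apply: (mulIf n1); rewrite -mulrA divfK// [RHS]mulrDl -(mulrA (expR K)) -e; ring.
set c := x - z; set d := 1 - x - y + z.
have /andP[kl ku] := expR_norm_itv K.
have kpos := expR_gt0 K.
have p1 : 0 < d + expR K * c by rewrite addr_gt0 ?mulr_gt0.
have p2 : 0 < d + c by rewrite addr_gt0.
split; first by rewrite divr_gt0.
have k1 : expR (- `|K|) <= 1 by rewrite expR_le1 oppr_le0.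
have k2 : 1 <= expR `|K| by rewrite -[leLHS]expR0 ler_expR.
rewrite ler_norml -[- `|K|]expRK -[X in _ && (_ <= X)]expRK.
rewrite !ler_ln ?posrE ?divr_gt0 ?expR_gt0//.
have {}a0 : 0 < c by []; have {}d0 : 0 < d by [].
clearbody c d; rewrite ler_pdivlMr// ler_pdivrMr// !mulrDr; apply/andP; split; apply: lerD.
- by rewrite ger_pMl.
- by rewrite ler_wpM2r// ltW.
- by rewrite ler_peMl// ltW.
- by rewrite ler_wpM2r// ltW.
Qed.

End Entropy.

(** * The projection and the size of the logit near the boundary *)

Section Clip.
Context {R : realType}.

Lemma natr_le_sqrt (M t : nat) : (M ^ 2 <= t)%N -> M%:R <= Num.sqrt t%:R :> R.
Proof.
move=> Mt; rewrite -[leLHS]ger0_norm// -sqrtr_sqr ler_sqrt//.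
by rewrite -natrX ler_nat.
Qed.

Lemma root4_expn (N : nat) : (N ^ 4)%:R `^ 4^-1 = N%:R :> R.
Proof. by rewrite natrX -powR_mulrn// -powRrM divff ?powRr1. Qed.

Lemma natr_le_root4 (N t : nat) : (N ^ 4 <= t)%N -> N%:R <= t%:R `^ 4^-1 :> R.
Proof.
by move=> Nt; rewrite -[leLHS]root4_expn ge0_ler_powR ?nnegrE ?invr_ge0 ?ler_nat.
Qed.

Lemma clip_itv (t : nat) (x : R) : (0 < t)%N ->
  10^-1 / (t%:R `^ 4^-1) <= clip t x <= 1 - 10^-1 / (t%:R `^ 4^-1).
Proof.
move=> t0; have r1 := @natr_le_root4 1 t t0.
have : 10^-1 / (t%:R `^ 4^-1) <= 10^-1 :> R by rewrite ler_pdivrMr; lra.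
rewrite /clip; set lo := _ / _ => lo1.
by case: ltP => h1; [|case: ltP => h2]; lra.
Qed.

Lemma clip_interior (t : nat) (x : R) : (0 < t)%N -> 0 < clip t x < 1.
Proof.
move=> t0; have := clip_itv t x t0; have r1 := @natr_le_root4 1 t t0.
have : 0 < 10^-1 / (t%:R `^ 4^-1) :> R by rewrite divr_gt0; lra.
lra.
Qed.

Lemma clip_id (N t : nat) (x : R) : (0 < N)%N -> (N ^ 4 <= t)%N ->
  10^-1 / N%:R <= x <= 1 - 10^-1 / N%:R -> clip t x = x.
Proof.
move=> N0 /natr_le_root4 Nt; have N0' : 0 < N%:R :> R by rewrite ltr0n.
have : 10^-1 / (t%:R `^ 4^-1) <= 10^-1 / N%:R :> R.
  by rewrite ler_pM2l// lef_pV2// posrE; lra.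
rewrite /clip; set lo := _ / _ => lo1 ?.
by case: ltP => h1; [|case: ltP => h2]; lra.
Qed.

(** From ln (1/x) <= 1/x - 1; crude, but polynomial in 1/dl, which the decay of the step size can
    absorb. *)
Lemma logit_bound (dl y : R) : 0 < dl -> dl <= y -> dl <= 1 - y ->
  `|ln ((1 - y) / y)| <= dl^-1.
Proof.
move=> d0 h1 h2; have hl (x : R) : dl <= x -> x <= 1 -> - dl^-1 + 1 <= ln x <= 0.
  move=> dx x1; have x0 : 0 < x by lra.
  have := ln_le0 x1.
  have := ln_le_sub1 x^-1; rewrite invr_gt0 lnV ?posrE// => /(_ x0).
  have : x^-1 <= dl^-1 by rewrite lef_pV2.
  lra.
have := hl y; have := hl (1 - y).
rewrite ln_div ?posrE ?ler_norml; lra.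
Qed.

End Clip.

(** * Bounds on the potentials, sensitivity of the BP map, and sums over neighbors *)

Lemma ln_norm_bound {R : realType} (p x : R) :
  p^-1 <= x <= p -> 0 < p -> `|ln x| <= ln p.
Proof.
move=> /andP[h1 h2] p0; have x0 : 0 < x by apply: lt_le_trans h1; rewrite invr_gt0.
by rewrite ler_norml -lnV ?posrE// !ler_ln ?posrE ?invr_gt0// h1.
Qed.

(** A zero potential would make [psi_norm] infinite. The bound 1 <= p stands under the quantifier
    because on an empty graph [psi_norm] is -oo and p is 0. *)
Lemma psi_norm_bounds {R : realType} {G : sgraph} (psi : mrf R G) :
  (psi_norm psi < +oo)%E ->
  let p := fine (psi_norm psi) in
  [/\ forall v a, 1 <= p /\ p^-1 <= vpot psi v a <= p &
      forall u v a b, adj u v -> p^-1 <= epot psi u v a b <= p].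
Proof.
move=> fin p.
have key (x : R) : 0 <= x -> (expeR `|lne x%:E| <= psi_norm psi)%E ->
    1 <= p /\ p^-1 <= x <= p.
  move=> x0 h; have := le_lt_trans h fin.
  rewrite /p; case: (psi_norm psi) fin h => [r| |] //= _.
    rewrite /lne; case: ifP => //= xle; rewrite lee_fin => h _.
    have {}x0 : 0 < x by rewrite ltNge xle.
    have r1 : 1 <= r by apply: le_trans h; rewrite -[leLHS]expR0 ler_expR.
    split=> //.
    have [h1 h2] : expR (ln x) <= r /\ expR (- ln x) <= r.
      by split; apply: le_trans h; rewrite ler_expR ?ler_norm// -normrN ler_norm.
    rewrite lnK ?posrE// in h1; rewrite expRN lnK ?posrE// in h2.
    by rewrite h1 andbT -[leRHS]invrK lef_pV2 ?posrE ?invr_gt0//; lra.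
  by case: ifP.
split=> [v a|u v a b uv].
  apply: key; first exact: vpot_ge0.
  rewrite /psi_norm le_max; apply/orP; left.
  exact: (@le_bigmax _ _ _ -oo%E
    (fun q : G * bool => expeR `|lne (vpot psi q.1 q.2)%:E|)%E (v, a)).
suff: 1 <= p /\ p^-1 <= epot psi u v a b <= p by case.
apply: key; first exact: epot_ge0.
rewrite /psi_norm le_max; apply/orP; right.
exact: (@le_bigmax_cond _ _ _ -oo%E ((u, v), (a, b))
   (fun q : (G * G) * (bool * bool) => adj q.1.1 q.1.2)
    (fun q : (G * G) * (bool * bool) =>
       expeR `|lne (epot psi q.1.1 q.1.2 q.2.1 q.2.2)%:E|)%E uv).
Qed.

(** Replacing X by E X changes a + b X, for positive a and b, by a factor between 1/M and M;
    numerator and denominator contribute one such factor each. *)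
Lemma linear_fraction_ratio {R : realType} (A B C D X E M : R) :
  0 < A -> 0 < B -> 0 < C -> 0 < D -> 0 < X -> 0 < E ->
  1 <= M -> E <= M -> 1 <= M * E ->
  let r := ((A + B * X) / (C + D * X)) / ((A + B * (E * X)) / (C + D * (E * X))) in
  r <= M ^+ 2 /\ 1 <= M ^+ 2 * r.
Proof.
move=> A0 B0 C0 D0 X0 E0 M1 EM ME r.
have gr (a b : R) : 0 < a -> 0 < b ->
    a + b * (E * X) <= M * (a + b * X) /\ a + b * X <= M * (a + b * (E * X)).
  move=> a0 b0; have bX : 0 < b * X by rewrite mulr_gt0.
  split; rewrite mulrDr; apply: lerD.
  - by rewrite ler_peMl// ltW.
  - by rewrite mulrCA ler_wpM2r// ltW.
  - by rewrite ler_peMl// ltW.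
  - rewrite (_ : M * (b * (E * X)) = (M * E) * (b * X)); last by ring.
    by rewrite ler_peMl// ltW.
have pos (a b : R) : 0 < a -> 0 < b -> 0 < a + b * X /\ 0 < a + b * (E * X).
  by move=> a0 b0; split; rewrite addr_gt0 ?mulr_gt0.
have [N0 N0'] := pos _ _ A0 B0; have [P0 P0'] := pos _ _ C0 D0.
have [g1 g2] := gr _ _ A0 B0; have [g3 g4] := gr _ _ C0 D0.
have -> : r = ((A + B * X) * (C + D * (E * X))) / ((C + D * X) * (A + B * (E * X))).
  by rewrite /r invf_div mulf_div.
have M0 : 0 <= M by lra.
split.
  rewrite ler_pdivrMr ?mulr_gt0//.
  have := ler_pM (ltW N0) (ltW P0') g2 g3; rewrite expr2; lra.
rewrite mulrA ler_pdivlMr ?mulr_gt0// mul1r.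
have := ler_pM (ltW P0) (ltW N0') g4 g1; rewrite expr2; lra.
Qed.

Lemma nbrE (G : sgraph) (u v : G) : (u \in nbr v) = adj v u.
Proof. by rewrite inE. Qed.

Lemma max_degreeP (G : sgraph) (v : G) : (#|nbr v| <= max_degree G)%N.
Proof. exact: (leq_bigmax v). Qed.

Lemma sum_nbr_sym {R : realType} (G : sgraph) (f : G -> G -> R) :
  \sum_v \sum_(u in nbr v) f u v = \sum_v \sum_(u in nbr v) f v u.
Proof.
rewrite (exchange_big_dep predT)//=; apply: eq_bigr => u _.
by apply: eq_bigl => v; rewrite !nbrE adj_sym.
Qed.

(** * Edge marginals, slopes and messages at arbitrary marginals *)

Section BetheFreeEnergy.
Context {R : realType} {G : sgraph} (psi : mrf R G) (p : R).
Hypotheses (p1 : 1 <= p) (vpotP : forall v a, p^-1 <= vpot psi v a <= p)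
  (epotP : forall u v a b, adj u v -> p^-1 <= epot psi u v a b <= p).
Implicit Types (y : G -> R) (u v w : G).

Local Notation interior y := (forall v : G, 0 < y v < 1).

Let p0 : 0 < p. Proof. exact: lt_le_trans p1. Qed.

Lemma ln_p_ge0 : 0 <= ln p. Proof. exact: ln_ge0. Qed.

Lemma vpot_gt0 v a : 0 < vpot psi v a.
Proof. by have /andP[h _] := vpotP v a; apply: lt_le_trans h; rewrite invr_gt0. Qed.

Lemma epot_gt0 u v a b : adj u v -> 0 < epot psi u v a b.
Proof.
by move=> uv; have /andP[h _] := epotP u v a b uv; apply: lt_le_trans h; rewrite invr_gt0.
Qed.

Lemma edge_Psi_bound u v : adj u v -> `|edge_Psi psi u v| <= 4 * ln p.
Proof.
move=> uv; have e0 a b := epot_gt0 u v a b uv.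
have eb a b := ln_norm_bound p _ (epotP u v a b uv) p0.
rewrite /edge_Psi ln_div ?posrE ?mulr_gt0// !lnM ?posrE//.
move: (eb false false) (eb true true) (eb true false) (eb false true).
rewrite !ler_norml; lra.
Qed.

Lemma vertex_Psi_bound v : `|vertex_Psi psi v| <= (2 + 2 * #|nbr v|%:R) * ln p.
Proof.
rewrite /vertex_Psi; apply: le_trans (ler_normD _ _) _; rewrite mulrDl lerD//.
  move: (ln_norm_bound p _ (vpotP v true) p0) (ln_norm_bound p _ (vpotP v false) p0).
  rewrite ln_div ?posrE ?vpot_gt0// !ler_norml; lra.
apply: le_trans (ler_norm_sum _ _ _) _.
rewrite mulrAC mulr_natr -sumr_const.
apply: ler_sum => u; rewrite nbrE adj_sym => uv.
have e0 a b := epot_gt0 u v a b uv.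
have eb a b := ln_norm_bound p _ (epotP u v a b uv) p0.
move: (eb false false) (eb false true).
rewrite ln_div ?posrE// !ler_norml; lra.
Qed.

Lemma edge_PsiC u v : adj u v -> edge_Psi psi v u = edge_Psi psi u v.
Proof.
by move=> uv; rewrite /edge_Psi !(epot_sym _ _ _ uv) (mulrC (epot psi u v true false)).
Qed.

Lemma y_edge_spec y u v : interior y ->
  edge_marginal_spec (edge_Psi psi u v) (y u) (y v) (y_edge psi y u v).
Proof.
move=> yI; have [z [zS _]] := edge_marginal_ex_unique (edge_Psi psi u v) (yI u) (yI v).
by rewrite /y_edge /edge_marginal; exact: (xgetPex 0 (ex_intro _ z zS)).
Qed.

Lemma y_edge_stationary y u v : interior y ->
  stationary (edge_Psi psi u v) (y u) (y v) (y_edge psi y u v).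
Proof. by move=> yI; apply/edge_marginal_specP/y_edge_spec. Qed.

Lemma edge_marginal_specC K (x y z : R) :
  edge_marginal_spec K x y z -> edge_marginal_spec K y x z.
Proof.
case=> z0 zm e; split=> //; first by rewrite minC.
by apply: etrans e; rewrite (addrAC 1); ring.
Qed.

(** By uniqueness, since the defining equation is symmetric in the two ends. *)
Lemma y_edgeC y u v : interior y -> adj u v -> y_edge psi y v u = y_edge psi y u v.
Proof.
move=> yI uv.
have [z [_ zU]] := edge_marginal_ex_unique (edge_Psi psi u v) (yI u) (yI v).
rewrite -(zU _ (y_edge_spec y u v yI)); symmetry; apply: zU.
by apply: edge_marginal_specC; rewrite -edge_PsiC//; exact: y_edge_spec.
Qed.

(* Minus the partial derivative of [bethe] below. *)
Definition slope y v : R :=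
  vertex_Psi psi v + ln ((1 - y v) / y v)
  + \sum_(u in nbr v)
      ln ((1 - y v - y u + y_edge psi y u v) / (1 - y v)
          * (y v / (y v - y_edge psi y u v))).

(** The messages of the algorithm as a function of the marginals; at [y_iter psi t] this unfolds to
    [message psi t]. *)
Definition bp_message y u v : R :=
  epot psi u v false true / epot psi u v false false
  * ((1 - y v - y u + y_edge psi y u v) / (1 - y v))
  * (y v / (y v - y_edge psi y u v)).

Lemma bp_message_gt0 y u v : interior y -> adj u v -> 0 < bp_message y u v.
Proof.
move=> yI uv; rewrite /bp_message -mulrA mulr_gt0 ?divr_gt0 ?epot_gt0//.
by have [] := stationary_ratio _ _ _ _ (y_edge_stationary y u v yI).
Qed.

(** The edge part of [vertex_Psi] supplies the factors that turn each ratio under the sum into a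
    message. A zero slope thus says that the incoming messages reproduce the odds of [y v]. *)
Lemma expR_slope y v : interior y ->
  expR (slope y v) = vpot psi v true / vpot psi v false * ((1 - y v) / y v)
    * \prod_(u in nbr v) bp_message y u v.
Proof.
move=> yI; have /andP[y0 y1] := yI v.
have -> : slope y v = ln (vpot psi v true / vpot psi v false) + ln ((1 - y v) / y v)
    + \sum_(u in nbr v) ln (bp_message y u v).
  rewrite /slope /vertex_Psi -!addrA; congr (_ + _); rewrite addrCA; congr (_ + _).
  rewrite -big_split/=; apply: eq_bigr => u; rewrite nbrE adj_sym => uv.
  have [r0 _] := stationary_ratio _ _ _ _ (y_edge_stationary y u v yI).
  by rewrite /bp_message -[in RHS]mulrA [RHS]lnM ?posrE ?divr_gt0 ?epot_gt0.
rewrite !expRD expR_sum !lnK ?posrE ?divr_gt0 ?vpot_gt0 ?subr_gt0//.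
congr (_ * _); apply: eq_bigr => u; rewrite nbrE adj_sym => uv.
by rewrite lnK ?posrE ?bp_message_gt0.
Qed.

(** A slope of size eps/4 perturbs the argument of the BP map by a factor within e^(eps/4) of 1,
    hence its value by a factor within e^(eps/2). *)
Lemma small_slope_fixpoint y eps : interior y -> 0 < eps < 1 ->
  (forall v, `|slope y v| <= eps / 4) -> approx_bp_fixpoint psi eps (bp_message y).
Proof.
move=> yI /andP[eps0 eps1] small u v uv.
have muv0 := bp_message_gt0 y u v yI uv; split=> //.
have vu : adj v u by rewrite adj_sym.
have mvu0 := bp_message_gt0 y v u yI vu.
set PI := \prod_(w in nbr u :\ v) _.
have e0 a b := epot_gt0 u v a b uv.
have PI0 : 0 < PI.
  by apply: prodr_gt0 => w; rewrite !inE adj_sym => /andP[_ wu]; exact: bp_message_gt0.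
have eE := expR_slope y u yI.
(* The message from v back to u, absent from the BP product, is split off; [mE] expresses it through
   the same edge marginal [z]. *)
rewrite (big_setD1 v) ?nbrE//= -/PI in eE.
have [[z0 c0 b0 d0] zE] := y_edge_stationary y u v yI.
set z := y_edge psi y u v in z0 c0 b0 d0 zE.
have mE : bp_message y v u = epot psi u v true false / epot psi u v false false
    * ((1 - y u - y v + z) / (1 - y u)) * (y u / (y u - z)).
  by rewrite /bp_message (y_edgeC y u v)// !(epot_sym _ _ _ uv).
have /andP[yu0 yu1] := yI u; have /andP[yv0 yv1] := yI v.
(* The BP map sends X to [bp_message y u v] exactly; its actual argument is
   [expR (slope y u)] times X, after the rescaling in [XE]. *)
set X := epot psi u v false false / epot psi u v true false
  * ((y u - z) / (1 - y u - y v + z)).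
have X0 : 0 < X by rewrite /X mulr_gt0 ?divr_gt0.
have wu0 := vpot_gt0 u true; have wu0' := vpot_gt0 u false.
have XE : vpot psi u true * PI = vpot psi u false * (expR (slope y u) * X).
  rewrite eE mE /X; field.
  by rewrite !gt_eqF// subr_gt0.
have -> : bp_fun psi u v PI =
    (epot psi u v false true + epot psi u v true true * (expR (slope y u) * X))
    / (epot psi u v false false + epot psi u v true false * (expR (slope y u) * X)).
  rewrite /bp_fun -!(mulrA _ (vpot psi u true)) XE !(mulrCA _ (vpot psi u false)).
  rewrite !(mulrC _ (vpot psi u false)) -!mulrDr -mulf_div divff ?mul1r// gt_eqF//.
have -> : bp_message y u v = (epot psi u v false true + epot psi u v true true * X)
    / (epot psi u v false false + epot psi u v true false * X).
  have en a b : epot psi u v a b != 0 by rewrite gt_eqF.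
  have [zn cn bn dn] : [/\ z != 0, y u - z != 0, y v - z != 0 & 1 - y u - y v + z != 0].
    by split; rewrite gt_eqF.
  have yvn : 1 - y v != 0 by rewrite gt_eqF ?subr_gt0.
  have -> : epot psi u v false false + epot psi u v true false * X
      = epot psi u v false false * ((1 - y v) / (1 - y u - y v + z)).
    by rewrite /X; field; rewrite dn en.
  have -> : epot psi u v false true + epot psi u v true true * X
      = epot psi u v false true * (y v / (y v - z)).
    have kE : expR (edge_Psi psi u v) = epot psi u v false false * epot psi u v true true
        / (epot psi u v true false * epot psi u v false true).
      by rewrite lnK// posrE divr_gt0 ?mulr_gt0.
    (* Introducing e^K exposes the product that the stationarity equation [zE] evaluates. *)
    have -> : epot psi u v true true * X
        = epot psi u v false true * ((expR (edge_Psi psi u v) * ((y u - z) * (y v - z)))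
           / ((1 - y u - y v + z) * (y v - z))).
      by rewrite kE /X; field; rewrite dn bn !en.
    by rewrite -zE; field; rewrite dn bn.
  rewrite /bp_message -/z (addrAC 1 (- y v)); field.
  by rewrite dn bn yvn en.
have := @linear_fraction_ratio _ _ _ _ _ X (expR (slope y u)) (expR (eps / 4))
  (e0 false true) (e0 true true) (e0 false false) (e0 true false) X0 (expR_gt0 _).
move: (small u); rewrite ler_norml => /andP[s1 s2].
have M1 : 1 <= expR (eps / 4) by rewrite -[leLHS]expR0 ler_expR divr_ge0 ?ltW.
have M2 : expR (slope y u) <= expR (eps / 4) by rewrite ler_expR.
have M3 : 1 <= expR (eps / 4) * expR (slope y u).
  by rewrite -expRD -[leLHS]expR0 ler_expR -lerBlDl sub0r.
move=> /(_ M1 M2 M3) /=.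
rewrite -expRM_natl; set r := _ / _ / _ => -[r1 r2].
(* From e^(-x) >= 1 - x at x = eps/2. Then 1/M >= 1 - eps/2, and M <= 1/(1 - eps/2) <= 1 + eps
   because eps < 1. *)
have Mb : expR (2%:R * (eps / 4)) * (1 - eps / 2) <= 1.
  have := @expR_ge1Dx R (- (eps / 2)) => h.
  have := ler_wpM2l (expR_ge0 (2%:R * (eps / 4))) h.
  rewrite -expRD (_ : 2%:R * (eps / 4) + - (eps / 2) = 0) ?expR0; lra.
have M0 := expR_gt0 (2%:R * (eps / 4)).
set M := expR _ in r1 r2 Mb M0.
rewrite ler_norml; apply/andP; split; nra.
Qed.

(** * The Bethe free energy: size and change under a small move *)

Local Notation D := (max_degree G).

(* The inner sum meets each edge twice, hence the factor 1/2. *)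
Definition bethe y : R :=
  \sum_v (- vertex_Psi psi v * y v + (1 - #|nbr v|%:R) * entropy (y v))
  + 2^-1 * \sum_v \sum_(u in nbr v)
      edge_energy (edge_Psi psi u v) (y u) (y v) (y_edge psi y u v).

Lemma card_nbr_le v : #|nbr v|%:R <= D%:R :> R.
Proof. by rewrite ler_nat max_degreeP. Qed.

(** Every p ln p lies in [-1, 0], so only degrees and interaction strengths enter. This bound,
    linear in n, is squared in the iteration count because the steps shrink like 1/sqrt t. *)
Lemma bethe_bound y : (0 < D)%N -> interior y ->
  `|bethe y| <= #|G|%:R * (6 * D%:R * (ln p + 1)).
Proof.
move=> D0 yI; have l0 := ln_p_ge0.
have D1 : 1 <= D%:R :> R by rewrite ler1n.
have sumG (f : G -> R) c : (forall v, `|f v| <= c) -> `|\sum_v f v| <= #|G|%:R * c.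
  move=> fc; apply: le_trans (ler_norm_sum _ _ _) _.
  by rewrite mulr_natl -sumr_const; apply: ler_sum => v _; exact: fc.
(* The first summand pays for the vertex terms, the second for the halved edge terms. *)
have -> : 6 * D%:R * (ln p + 1) = (4 * D%:R * ln p + 4 * D%:R)
    + 2^-1 * (D%:R * (4 + 4 * ln p)) by field.
rewrite /bethe mulrDr; apply: le_trans (ler_normD _ _) _; apply: lerD.
  apply: sumG => v; apply: le_trans (ler_normD _ _) _; apply: lerD.
    rewrite normrM normrN; apply: (@le_trans _ _ (`|vertex_Psi psi v| * 1)).
      by apply: ler_wpM2l => //; have /andP[? ?] := yI v; rewrite gtr0_norm// ltW.
    rewrite mulr1; apply: le_trans (vertex_Psi_bound v) _.
    by apply: ler_wpM2r => //; have := card_nbr_le v; lra.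
  have /entropy_itv/andP[h1 h2] := yI v.
  apply: (@le_trans _ _ ((2 * D%:R) * 2)); last lra.
  rewrite normrM; apply: ler_pM => //; rewrite ler_norml; last lra.
  by have := card_nbr_le v; have := ler0n R #|nbr v|; lra.
rewrite normrM gtr0_norm// mulrCA ler_pM2l//.
apply: sumG => v; apply: le_trans (ler_norm_sum _ _ _) _.
apply: (@le_trans _ _ (\sum_(u in nbr v) (4 + 4 * ln p))).
  apply: ler_sum => u; rewrite nbrE adj_sym => uv.
  have [f _] := y_edge_stationary y u v yI.
  have /andP[_ yu1] := yI u; have /andP[_ yv1] := yI v.
  apply: le_trans (edge_energy_itv _ _ _ _ yu1 yv1 f) _.
  by rewrite lerD2l; exact: edge_Psi_bound.
rewrite sumr_const -[leLHS]mulr_natl; apply: ler_wpM2r; first lra.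
exact: card_nbr_le.
Qed.

(* The old edge marginals remain feasible for y', and they overestimate the
   minimum over edge marginals, so their dependence on y never has to be
   differentiated. *)
Lemma bethe_descent y y' m : interior y -> interior y' -> 0 < m ->
  (forall v, m <= y v) -> (forall v, m <= 1 - y v) ->
  (forall u v, adj u v -> let z := y_edge psi y u v in
     [/\ m <= z, m <= y u - z, m <= y v - z & m <= 1 - y u - y v + z]) ->
  (forall v, `|y' v - y v| <= m / 4) ->
  bethe y' <= bethe y - \sum_v slope y v * (y' v - y v)
    + (3 * D%:R + 2) / m * \sum_v (y' v - y v) ^+ 2.
Proof.
move=> yI y'I m0 my my' mE dy.
pose d v := y' v - y v.
(* Derivative of the edge energy in [y v], the edge marginal being held fixed. *)
pose L u v := ln ((y v - y_edge psi y u v) / (1 - y u - y v + y_edge psi y u v)).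
have edgeP u v : adj u v ->
  edge_energy (edge_Psi psi u v) (y' u) (y' v) (y_edge psi y' u v)
   <= edge_energy (edge_Psi psi u v) (y u) (y v) (y_edge psi y u v)
      + (d u * L v u + 3 / m * d u ^+ 2) + (d v * L u v + 3 / m * d v ^+ 2).
  move=> uv; have [h1 h2 h3 h4] := mE u v uv.
  (* A cell changes by at most two increments of m/4, so it stays positive. *)
  have f : feasible (y' u) (y' v) (y_edge psi y u v).
    move: (dy u) (dy v); rewrite !ler_norml /feasible; split; lra.
  apply: le_trans (edge_energy_min _ _ _ _ _ (y_edge_stationary y' u v y'I) f) _.
  apply: le_trans (edge_energy_move _ _ _ _ _ _ _ m0 h1 h2 h3 h4 f) _.
  rewrite /L (y_edgeC y u v)// (addrAC 1 (- y v)) -/(d u) -/(d v).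
  by rewrite le_eqVlt; apply/orP; left; apply/eqP; ring.
have vertexP v : - vertex_Psi psi v * y' v + (1 - #|nbr v|%:R) * entropy (y' v)
   <= - vertex_Psi psi v * y v + (1 - #|nbr v|%:R) * entropy (y v)
     + ((1 - #|nbr v|%:R) * ln (y v / (1 - y v)) - vertex_Psi psi v) * d v
     + 2 / m * d v ^+ 2.
  have := entropy_move #|nbr v| m (y v) (y' v) m0 (my v) (my' v) (y'I v).
  rewrite -/(d v) => h; have e : y' v = y v + d v by rewrite /d; ring.
  rewrite {1}e; lra.
(* Each neighbor contributes one ln (y/(1 - y)); together with the logit these give the weight 1 -
   deg v of the vertex entropy. *)
have slopeP v : slope y v = vertex_Psi psi v
    - (1 - #|nbr v|%:R) * ln (y v / (1 - y v)) - \sum_(u in nbr v) L u v.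
  have /andP[y0 y1] := yI v.
  have -> : slope y v = vertex_Psi psi v + ln ((1 - y v) / y v)
      + \sum_(u in nbr v) (ln (y v / (1 - y v)) - L u v).
    congr (_ + _); apply: eq_bigr => u; rewrite nbrE adj_sym => uv.
    have [[z0 a0 b0 d0] _] := y_edge_stationary y u v yI.
    have y1' : 0 < 1 - y v by rewrite subr_gt0.
    have d1 : 0 < 1 - y u - y v + y_edge psi y u v by [].
    rewrite /L -ln_div ?posrE ?divr_gt0//.
    rewrite (addrAC 1 (- y v)); congr ln; field.
    by rewrite !gt_eqF// subr_gt0.
  rewrite big_split/= sumrN sumr_const -(mulr_natl (ln _)).
  have -> : ln ((1 - y v) / y v) = - ln (y v / (1 - y v)).
    by rewrite -lnV ?invf_div// posrE divr_gt0 ?subr_gt0.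
  ring.
have -> : \sum_v slope y v * (y' v - y v) =
    \sum_v (vertex_Psi psi v - (1 - #|nbr v|%:R) * ln (y v / (1 - y v))) * d v
    - \sum_v \sum_(u in nbr v) d v * L u v.
  rewrite -sumrB; apply: eq_bigr => v _; rewrite slopeP -mulr_sumr -/(d v); ring.
(* Each edge is visited from both ends; exchanging the ends in half of the increments gives the
   factor 2 that cancels the 1/2 in [bethe]. *)
have sumE : \sum_v \sum_(u in nbr v)
      edge_energy (edge_Psi psi u v) (y' u) (y' v) (y_edge psi y' u v)
  <= \sum_v \sum_(u in nbr v) edge_energy (edge_Psi psi u v) (y u) (y v) (y_edge psi y u v)
    + 2 * (\sum_v \sum_(u in nbr v) d v * L u v + 3 * D%:R / m * \sum_v d v ^+ 2).
  apply: (@le_trans _ _ (\sum_v \sum_(u in nbr v)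
      (edge_energy (edge_Psi psi u v) (y u) (y v) (y_edge psi y u v)
      + (d u * L v u + 3 / m * d u ^+ 2) + (d v * L u v + 3 / m * d v ^+ 2)))).
    by apply: ler_sum => v _; apply: ler_sum => u; rewrite nbrE adj_sym; exact: edgeP.
  have sumD (A B : G -> G -> R) : \sum_v \sum_(u in nbr v) (A u v + B u v)
      = \sum_v \sum_(u in nbr v) A u v + \sum_v \sum_(u in nbr v) B u v.
    by rewrite -big_split/=; apply: eq_bigr => v _; rewrite big_split.
  pose B u v := d v * L u v + 3 / m * d v ^+ 2.
  rewrite (sumD (fun u v => edge_energy (edge_Psi psi u v) (y u) (y v) (y_edge psi y u v)
    + B v u) B) (sumD _ (fun u v => B v u)) (sum_nbr_sym G (fun u v => B v u)) /B !sumD.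
  have : \sum_v \sum_(u in nbr v) 3 / m * d v ^+ 2 <= 3 * D%:R / m * \sum_v d v ^+ 2.
    rewrite mulr_sumr; apply: ler_sum => v _; rewrite sumr_const -[leLHS]mulr_natr.
    have -> : 3 * D%:R / m * d v ^+ 2 = 3 / m * d v ^+ 2 * D%:R by ring.
    apply: ler_wpM2l (card_nbr_le v).
    by rewrite mulr_ge0 ?sqr_ge0// divr_ge0// ltW.
  lra.
have sumV : \sum_v (- vertex_Psi psi v * y' v + (1 - #|nbr v|%:R) * entropy (y' v))
  <= \sum_v (- vertex_Psi psi v * y v + (1 - #|nbr v|%:R) * entropy (y v))
    - \sum_v (vertex_Psi psi v - (1 - #|nbr v|%:R) * ln (y v / (1 - y v))) * d v
    + 2 / m * \sum_v d v ^+ 2.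
  rewrite mulr_sumr -sumrN -!big_split/=; apply: ler_sum => v _.
  by have := vertexP v; lra.
rewrite /bethe -/(d _) in sumV sumE *.
have -> : (3 * D%:R + 2) / m * \sum_v (y' v - y v) ^+ 2
  = 3 * D%:R / m * \sum_v d v ^+ 2 + 2 / m * \sum_v d v ^+ 2 by rewrite /d; ring.
lra.
Qed.

(* Every term of the slope but the entropic one is at most [ln Q] in total.
   From iteration N^4 on the clipping level is below 1 / (10 N); from N^16 on
   a step is also small compared with the cell probabilities, of order N^-3. *)
Context (Q : R) (N : nat).
Hypotheses (D0 : (0 < D)%N) (Q1 : 1 <= Q) (pQ : 8 * D%:R * ln p <= ln Q)
  (DQ : D%:R <= Q) (QN : 100 * Q <= N%:R).

Let N0 : (0 < N)%N.
Proof. by have : 0 < N%:R :> R; [move: Q1 QN; lra | rewrite ltr0n]. Qed.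

Let dl : R := 10^-1 / N%:R.
Let dl0 : 0 < dl. Proof. by rewrite divr_gt0// ltr0n. Qed.

(** * Confinement of the iterates away from 0 and 1 *)

Definition inner y := forall v, dl <= y v <= 1 - dl.

Lemma inner_interior y : inner y -> interior y.
Proof. by move=> yI v; move: (yI v) dl0; lra. Qed.

Lemma y_iterS t : (0 < t)%N -> y_iter psi t.+1 = y_update psi t (y_iter psi t).
Proof. by case: t. Qed.

Lemma y_iter_interior t : interior (y_iter psi t).
Proof.
case: t => [|[|t]] v; [by rewrite /= invr_gt0 ltr0n invf_lt1 ?ltr1n..|].
by rewrite y_iterS//; exact: clip_interior.
Qed.

Lemma slope_logit y v : interior y -> `|slope y v - ln ((1 - y v) / y v)| <= ln Q.
Proof.
move=> yI; have l0 := ln_p_ge0.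
apply: (@le_trans _ _ ((2 + 2 * D%:R) * ln p + D%:R * (4 * ln p))); last first.
  have : ln p <= D%:R * ln p by rewrite ler_peMl// ler1n.
  by move: pQ; lra.
rewrite /slope addrAC addrK.
apply: le_trans (ler_normD _ _) _; apply: lerD.
  apply: le_trans (vertex_Psi_bound v) _.
  by rewrite ler_wpM2r// lerD2l ler_pM2l// card_nbr_le.
apply: le_trans (ler_norm_sum _ _ _) _.
apply: (@le_trans _ _ (\sum_(u in nbr v) (4 * ln p))).
  apply: ler_sum => u; rewrite nbrE adj_sym => uv.
  have [_ h] := stationary_ratio _ _ _ _ (y_edge_stationary y u v yI).
  exact: le_trans h (edge_Psi_bound u v uv).
rewrite sumr_const -[leLHS]mulr_natl ler_wpM2r ?card_nbr_le//; lra.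
Qed.

(** The logit contributes at most 1/dl = 10 N and the rest at most ln Q <= Q <= N. *)
Lemma slope_bound y v : inner y -> `|slope y v| <= 11 * N%:R.
Proof.
move=> yI; have := slope_logit y v (inner_interior y yI).
have /andP[h1 h2] := yI v.
have h3 : dl <= 1 - y v by lra.
have := logit_bound dl (y v) dl0 h1 h3; rewrite /dl invf_div invrK.
have Q0 : 0 < Q by move: Q1; lra.
have := ln_le_sub1 Q Q0; move: Q1 QN; rewrite !ler_norml; lra.
Qed.

(** The odds (1 - y)/y are at least 2Q - 1 >= Q, so the entropic term outweighs all others. *)
Lemma slope_ge0 y v : interior y -> y v * (2 * Q) <= 1 -> 0 <= slope y v.
Proof.
move=> yI h; have := slope_logit y v yI; have /andP[y0 y1] := yI v.
have : ln Q <= ln ((1 - y v) / y v).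
  rewrite ler_ln ?posrE ?divr_gt0 ?subr_gt0//; last by move: Q1; lra.
  by rewrite ler_pdivlMr//; move: Q1; nra.
rewrite !ler_norml; lra.
Qed.

Lemma slope_le0 y v : interior y -> (1 - y v) * (2 * Q) <= 1 -> slope y v <= 0.
Proof.
move=> yI h; have := slope_logit y v yI; have /andP[y0 y1] := yI v.
have : ln ((1 - y v) / y v) <= - ln Q.
  rewrite -lnV ?posrE//; last by move: Q1; lra.
  rewrite ler_ln ?posrE ?divr_gt0 ?subr_gt0 ?invr_gt0//; try by move: Q1; lra.
  by rewrite ler_pdivrMr// ler_pdivlMl; move: Q1; nra.
rewrite !ler_norml; lra.
Qed.

(** Since sqrt t >= N^2, a step has length at most 11/N <= 0.11/Q. Within 1/(2Q) of an end it points
    inward; farther away it is too short to come within [dl] of that end. *)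
Lemma inner_step t y v : (N ^ 4 <= t)%N -> inner y ->
  dl <= y v + (Num.sqrt t%:R)^-1 * slope y v <= 1 - dl.
Proof.
move=> Nt yI; have yI' := inner_interior y yI.
set eta := _^-1; set g := slope y v.
have Npos : 0 < N%:R :> R by rewrite ltr0n.
have s0 : N%:R ^+ 2 <= Num.sqrt t%:R :> R.
  by rewrite -natrX; apply: natr_le_sqrt; rewrite -expnM.
have e0 : 0 < eta.
  by rewrite invr_gt0; apply: lt_le_trans s0; rewrite exprn_gt0.
have step : `|eta * g| * N%:R <= 11.
  rewrite normrM gtr0_norm//.
  apply: (@le_trans _ _ (eta * (11 * N%:R) * N%:R)).
    by rewrite ler_pM2r// ler_pM2l//; exact: slope_bound.
  rewrite (_ : eta * (11 * N%:R) * N%:R = 11 * (N%:R ^+ 2 / Num.sqrt t%:R));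
    last by rewrite /eta; ring.
  rewrite -[leRHS]mulr1 ler_pM2l// ler_pdivrMr ?mul1r//.
  by apply: lt_le_trans s0; rewrite exprn_gt0.
have Q0 : 0 < Q by move: Q1; lra.
have Nq : N%:R^-1 <= Q^-1 / 100.
  by rewrite -invfM lef_pV2 ?posrE ?mulr_gt0// mulrC.
have step' : `|eta * g| <= 11 * N%:R^-1 by rewrite -ler_pdivlMr in step.
have q1 : Q^-1 <= 1 by rewrite invf_le1.
have q0 : 0 < Q^-1 by rewrite invr_gt0.
have qE : Q^-1 / 2 * (2 * Q) = 1 by field; rewrite gt_eqF.
have dlE : dl = 10^-1 * N%:R^-1 by [].
have /andP[x0 x1] := yI v.
have h0 : y v <= Q^-1 / 2 -> 0 <= eta * g.
  move=> h; rewrite mulr_ge0 ?(ltW e0)//; apply: slope_ge0 => //.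
  by rewrite -[leRHS]qE ler_pM2r ?mulr_gt0.
have h1 : 1 - y v <= Q^-1 / 2 -> eta * g <= 0.
  move=> h; rewrite pmulr_rle0//; apply: slope_le0 => //.
  by rewrite -[leRHS]qE ler_pM2r ?mulr_gt0.
move: step'; rewrite ler_norml => /andP[g1 g2].
by case: (leP (y v) (Q^-1 / 2)) h0 => [yq /(_ isT)|yq _];
  case: (leP (1 - y v) (Q^-1 / 2)) h1 => [yq' /(_ isT)|yq' _]; lra.
Qed.

Lemma y_updateE t y v :
  y_update psi t y v = clip t (y v + (Num.sqrt t%:R)^-1 * slope y v).
Proof. by []. Qed.

Lemma inner_iter t : (N ^ 4 < t)%N -> inner (y_iter psi t).
Proof.
elim: t => // t IH; rewrite ltnS leq_eqVlt => /orP[/eqP <-|Nt] v.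
  (* The clipping level at iteration N^4 is exactly [dl], so the projection itself starts the
     induction. *)
  have N40 : (0 < N ^ 4)%N by rewrite expn_gt0 N0.
  by rewrite y_iterS// /dl -(root4_expn N); exact: clip_itv.
rewrite y_iterS; last exact: leq_ltn_trans Nt.
have h := inner_step t _ v (ltnW Nt) (IH Nt).
by rewrite y_updateE (clip_id N)// ltnW.
Qed.

Lemma y_iter_step t v : (N ^ 4 < t)%N ->
  y_iter psi t.+1 v = y_iter psi t v + (Num.sqrt t%:R)^-1 * slope (y_iter psi t) v.
Proof.
move=> Nt; rewrite y_iterS; last exact: leq_ltn_trans Nt.
have h := inner_step t _ v (ltnW Nt) (inner_iter t Nt).
by rewrite y_updateE (clip_id N)// ltnW.
Qed.

(** * Decrease along the iteration and arrival at a fixed point *)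

(** A step adds eta times the slope, so the linear gain is eta S with S the sum of squared slopes;
    eta times the curvature constant is at most 1/2, so the quadratic error costs at most half of
    it. *)
Lemma bethe_iter_descent t : (N ^ 16 <= t)%N ->
  bethe (y_iter psi t.+1) <= bethe (y_iter psi t)
    - (2 * Num.sqrt t%:R)^-1 * \sum_v slope (y_iter psi t) v ^+ 2.
Proof.
move=> Nt; set y := y_iter psi t.
have Npos : 0 < N%:R :> R by rewrite ltr0n.
pose x : R := N%:R^-1.
have x0 : 0 < x by rewrite invr_gt0.
have Q0 : 0 < Q by move: Q1; lra.
have N100 : 100 <= N%:R :> R by move: Q1 QN; lra.
have x100 : x <= 100^-1 by rewrite lef_pV2// posrE.
have N4 : (N ^ 4 < t)%N.
  by apply: leq_trans Nt; rewrite ltn_exp2l// -(ltr_nat R); lra.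
have yI v : dl <= y v <= 1 - dl := inner_iter t N4 v; have yI' := inner_interior _ yI.
have Nx : N%:R = x^-1 :> R by rewrite /x invrK.
have dlx : dl = x / 10 by rewrite mulrC.
(* |K| <= 4 ln p <= ln Q gives e^(-|K|) >= 1/Q >= 100 x; with dl = x/10 the cells are then at least
   x^3/4. *)
have K4 u v : adj u v -> 100 * x <= expR (- `|edge_Psi psi u v|).
  move=> uv; apply: (@le_trans _ _ Q^-1).
    suff : x <= Q^-1 / 100 by lra.
    by rewrite /x -invfM lef_pV2 ?posrE ?mulr_gt0// mulrC.
  rewrite -[Q^-1]lnK ?posrE ?invr_gt0// ler_expR lnV ?posrE// lerN2.
  apply: le_trans (edge_Psi_bound u v uv) _.
  have := ln_p_ge0 => l0.
  have : ln p <= D%:R * ln p by rewrite ler_peMl// ler1n.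
  by move: pQ; lra.
have cells u v : adj u v -> let z := y_edge psi y u v in
   [/\ x ^+ 3 / 4 <= z, x ^+ 3 / 4 <= y u - z, x ^+ 3 / 4 <= y v - z
     & x ^+ 3 / 4 <= 1 - y u - y v + z].
  move=> uv /=; have /andP[u0 u1] := yI u; have /andP[v0 v1] := yI v.
  have u1' : dl <= 1 - y u by lra.
  have v1' : dl <= 1 - y v by lra.
  have [] := stationary_cells _ _ _ _ dl (y_edge_stationary y u v yI') dl0 u0 u1' v0 v1'.
  have : x ^+ 3 / 4 <= expR (- `|edge_Psi psi u v|) * (dl ^+ 2 / 4).
    have -> : x ^+ 3 / 4 = 100 * x * (dl ^+ 2 / 4) by rewrite dlx; field.
    by rewrite ler_wpM2r ?divr_ge0 ?sqr_ge0//; exact: K4.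
  move=> h h1 h2 h3 h4; split; exact: le_trans h _.
pose eta : R := (Num.sqrt t%:R)^-1.
have s0 : x ^- 8 <= Num.sqrt t%:R.
  by rewrite /x -exprVn invrK -natrX natr_le_sqrt// -expnM.
have e0 : 0 < eta by rewrite invr_gt0; apply: lt_le_trans s0; rewrite invr_gt0 exprn_gt0.
have e8 : eta <= x ^+ 8.
  rewrite /eta -[leRHS]invrK lef_pV2// posrE ?invr_gt0 ?exprn_gt0//.
  by rewrite -invr_gt0.
have m0 : 0 < x ^+ 3 / 4 by rewrite divr_gt0 ?exprn_gt0.
have stepE v : y_iter psi t.+1 v - y v = eta * slope y v.
  by rewrite y_iter_step// addrC addKr.
have xx3 : x ^+ 3 <= x / 10.
  by rewrite exprS ler_pM2l// expr2; nra.
have x4 : x ^+ 4 <= 100^-1 ^+ 4 by rewrite lerXn2r ?nnegrE ?(ltW x0) ?invr_ge0.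
apply: le_trans (bethe_descent y (y_iter psi t.+1) (x ^+ 3 / 4) yI'
  (y_iter_interior t.+1) m0 _ _ cells _) _.
- by move=> v; have /andP[+ _] := yI v; rewrite dlx; lra.
- by move=> v; have /andP[_ +] := yI v; rewrite dlx; lra.
- move=> v; rewrite stepE normrM gtr0_norm//.
  apply: (@le_trans _ _ (x ^+ 8 * (11 * N%:R))).
    by rewrite ler_pM ?(ltW e0)//; exact: slope_bound.
  have -> : x ^+ 8 * (11 * N%:R) = x ^+ 3 * (11 * x ^+ 4).
    by rewrite Nx; field; rewrite gt_eqF.
  have -> : x ^+ 3 / 4 / 4 = x ^+ 3 * 16^-1 by field.
  by rewrite ler_pM2l ?exprn_gt0//; lra.
set S := \sum_v slope y v ^+ 2.
have S0 : 0 <= S by apply: sumr_ge0 => v _; exact: sqr_ge0.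
have -> : \sum_v slope y v * (y_iter psi t.+1 v - y v) = eta * S.
  by rewrite mulr_sumr; apply: eq_bigr => v _; rewrite stepE; ring.
have -> : \sum_v (y_iter psi t.+1 v - y v) ^+ 2 = eta ^+ 2 * S.
  by rewrite mulr_sumr; apply: eq_bigr => v _; rewrite stepE; ring.
rewrite (invfM 2) -/eta.
(* D <= Q <= N/100 gives 3 D + 2 <= N/20, so the left side is at most N/20 times 4 N^3 times N^-8,
   that is x^4/5. *)
have Lb : (3 * D%:R + 2) / (x ^+ 3 / 4) * eta <= 2^-1.
  apply: (@le_trans _ _ (x^-1 / 20 / (x ^+ 3 / 4) * x ^+ 8)).
    have L0 : 3 * D%:R + 2 <= x^-1 / 20 by rewrite -Nx; move: Q1 QN DQ; lra.
    have L1 : 0 <= (3 * D%:R + 2 : R) by have := ler0n R D; lra.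
    rewrite ler_pM ?(ltW e0)// ?ler_wpM2r// ?invr_ge0 ?(ltW m0)//.
    by rewrite mulr_ge0 ?invr_ge0 ?(ltW m0).
  have -> : x^-1 / 20 / (x ^+ 3 / 4) * x ^+ 8 = x ^+ 4 / 5 by field; rewrite gt_eqF.
  lra.
have := ler_wpM2r (mulr_ge0 (ltW e0) S0) Lb.
set c := (3 * D%:R + 2) / (x ^+ 3 / 4).
have -> : c * eta * (eta * S) = c * (eta ^+ 2 * S) by ring.
move: (c * _) => q; lra.
Qed.

(** Otherwise every iteration from N^16 to E = 2 N^16 + W lowers the free energy by at least
    eps^2/(32 sqrt E). These are at least E/2 iterations and the total drop is at most 2A, so sqrt E
    <= 128 A/eps^2, against the choice of W. *)
Lemma bp_fixpoint_reached (eps A : R) (W : nat) : 0 < eps < 1 ->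
  (forall y, interior y -> `|bethe y| <= A) ->
  (128 * A / eps ^+ 2) ^+ 2 < W%:R ->
  exists2 t, (0 < t < 2 * N ^ 16 + W)%N & approx_bp_fixpoint psi eps (message psi t).
Proof.
move=> epsP betheA WA; apply: contrapT => none.
have /andP[eps0 eps1] := epsP.
have [T1 T1E] : exists T1, T1 = (N ^ 16)%N by exists (N ^ 16)%N.
rewrite -T1E in none; have T10 : (0 < T1)%N by rewrite T1E expn_gt0 N0.
set E := (2 * T1 + W)%N.
have E0 : 0 < E%:R :> R by rewrite ltr0n ltn_addr// muln_gt0 T10.
have sE0 : 0 < Num.sqrt E%:R :> R by rewrite sqrtr_gt0.
(* Some slope exceeds eps/4, and 1/(2 sqrt t) >= 1/(2 sqrt E) for t <= E. *)
pose c : R := eps ^+ 2 / (32 * Num.sqrt E%:R).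
have drop k : (k <= T1 + W)%N ->
    bethe (y_iter psi (T1 + k)) <= bethe (y_iter psi T1) - k%:R * c.
  elim: k => [_|k IH kE]; first by rewrite addn0 mul0r subr0.
  have {}IH := IH (ltnW kE).
  set t := (T1 + k)%N in IH *; rewrite addnS -/t.
  have t0 : (0 < t)%N by rewrite ltn_addr.
  have tE : (t < E)%N by move: kE; rewrite /t /E; clear; lia.
  have [v vP] : exists v, eps / 4 < `|slope (y_iter psi t) v|.
    apply: contrapT => small; apply: none; exists t; first by rewrite t0.
    apply: small_slope_fixpoint => // [|v].
      exact: y_iter_interior.
    by rewrite leNgt; apply/negP => h; apply: small; exists v.
  have S1 : (eps / 4) ^+ 2 <= \sum_v slope (y_iter psi t) v ^+ 2.
    rewrite (bigD1 v)//= -[leLHS]addr0; apply: lerD; last first.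
      by apply: sumr_ge0 => w _; exact: sqr_ge0.
    rewrite -(real_normK (num_real (slope _ _))) lerXn2r ?nnegrE//; last exact: ltW.
    by rewrite divr_ge0// ltW.
  have tT : (N ^ 16 <= t)%N by rewrite -T1E leq_addr.
  apply: le_trans (bethe_iter_descent t tT) _.
  have st : 0 < 2 * Num.sqrt t%:R :> R by rewrite mulr_gt0// sqrtr_gt0 ltr0n.
  have cS : c <= (2 * Num.sqrt t%:R)^-1 * \sum_v slope (y_iter psi t) v ^+ 2.
    have -> : c = (2 * Num.sqrt E%:R)^-1 * (eps / 4) ^+ 2.
      by rewrite /c; field; rewrite gt_eqF.
    apply: ler_pM S1; rewrite ?sqr_ge0// ?invr_ge0 ?mulr_ge0 ?sqrtr_ge0//.
    rewrite lef_pV2 ?posrE ?st ?mulr_gt0// ler_pM2l// ler_sqrt//.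
    by rewrite ler_nat ltnW.
  have : k.+1%:R * c = k%:R * c + c by rewrite -natr1 mulrDl mul1r.
  move: cS IH; move: (_^-1 * _) => X; clearbody c; lra.
have /= := drop _ (leqnn _).
have := betheA _ (y_iter_interior T1).
have := betheA _ (y_iter_interior (T1 + (T1 + W))).
rewrite !ler_norml => /andP[h1 h2] /andP[h3 h4] h5.
have kE : Num.sqrt E%:R ^+ 2 <= 2 * (T1 + W)%:R :> R.
  by rewrite sqr_sqrtr ?ler0n// -natrM ler_nat /E; clear; lia.
have : (T1 + W)%:R * c <= 2 * A by lra.
rewrite /c mulrA ler_pdivrMr ?mulr_gt0// => h6.
have eps20 : 0 < eps ^+ 2 by rewrite exprn_gt0.
have sEA : Num.sqrt E%:R <= 128 * A / eps ^+ 2.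
  rewrite ler_pdivlMr// -(ler_pM2l sE0).
  have := ler_wpM2r (ltW eps20) kE; lra.
have : E%:R <= (128 * A / eps ^+ 2) ^+ 2.
  rewrite -[leLHS](sqr_sqrtr (ltW E0)) lerXn2r ?nnegrE// ?(ltW sE0)//.
  exact: le_trans (ltW sE0) sEA.
apply/negP; rewrite -ltNge; apply: lt_le_trans WA _.
by rewrite ler_nat /E leq_addl.
Qed.

End BetheFreeEnergy.

(** * Absorbing the constants into the stated bound *)

Section Budget.
Context {R : realType}.

(** Absorbs numerical constants into (|psi| + 2)^O(Delta), given |psi| + 2 >= 3 and Delta >= 1. *)
Lemma ler_pow_base (P c : R) (k D : nat) : 3 <= P -> (0 < D)%N ->
  c <= 3 ^+ k -> c <= P ^+ (k * D).
Proof.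
move=> P3 D0 ck; apply: le_trans ck _.
apply: (@le_trans _ _ (P ^+ k)); first by rewrite lerXn2r ?nnegrE//; lra.
by rewrite ler_eXn2l ?leq_pmulr//; lra.
Qed.

Lemma natr_le_pow (P : R) (D : nat) : 3 <= P -> D%:R <= P ^+ D.
Proof.
move=> P3; apply: (@le_trans _ _ (2 ^+ D)).
  by rewrite -natrX ler_nat ltnW// ltn_expl.
by rewrite lerXn2r ?nnegrE//; lra.
Qed.

(** With P = p + 2: N <= P^(13 D), so 2 N^16 + 1 <= P^(209 D), and the squared term is at most
    P^(209 D) n^2 eps^-4. A factor P^D absorbs the sum of the two. As ln (n/eps) >= ln 2 >= 1/2, a
    factor P^(2 D) pays for inserting the cubed logarithm; 209 + 1 + 2 = 212. *)
Lemma iteration_budget (p n eps T N : R) (D : nat) : (0 < D)%N -> 1 <= p ->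
  2 <= n -> 0 < eps < 1 -> 0 <= N -> N <= 100 * (p + 2) ^+ (8 * D) + 1 ->
  T <= 2 * N ^+ 16 + ((128 * (n * (6 * D%:R * (ln p + 1))) / eps ^+ 2) ^+ 2 + 1) ->
  T <= (p + 2) ^+ (212 * D) * n ^+ 2 * eps ^- 4 * ln (n / eps) ^+ 3.
Proof.
move=> D0 p1 n2 /andP[e0 e1] N0 NQ TN; apply: le_trans TN _.
set P := p + 2 in NQ *; have P3 : 3 <= P by rewrite /P; lra.
have pow1 k : 1 <= P ^+ k by apply: exprn_ege1; lra.
have powD j k : P ^+ (j * D) * P ^+ (k * D) = P ^+ ((j + k) * D) by rewrite mulnDl exprD.
have bigc c k : c <= 3 ^+ k -> c <= P ^+ (k * D) by exact: ler_pow_base.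
have l0 : 0 <= ln p by exact: ln_ge0.
have NP : N <= P ^+ (13 * D).
  apply: le_trans NQ _; have := pow1 (8 * D)%N; rewrite -(powD 5 8)%N.
  have : 101 <= P ^+ (5 * D) by apply: bigc; lra.
  set a := P ^+ (5 * D); set b := P ^+ (8 * D) => h1 h2.
  have : 101 * b <= a * b by rewrite ler_wpM2r//; lra.
  lra.
have NP16 : 2 * N ^+ 16 + 1 <= P ^+ (209 * D).
  have h1 : 3 <= P ^+ (1 * D) by apply: bigc; lra.
  have h2 : N ^+ 16 <= P ^+ (208 * D).
    have -> : (208 * D = 13 * D * 16)%N by rewrite mulnAC.
    by rewrite exprM lerXn2r// nnegrE; apply: le_trans NP.
  rewrite -(powD 1 208)%N; have h3 := pow1 (208 * D)%N.
  have : 3 * P ^+ (208 * D) <= P ^+ (1 * D) * P ^+ (208 * D) by rewrite ler_wpM2r//; lra.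
  lra.
have AP : 128 * (6 * D%:R * (ln p + 1)) <= P ^+ (9 * D).
  have h1 : 768 <= P ^+ (7 * D) by apply: bigc; lra.
  have h2 : D%:R <= P ^+ (1 * D) by rewrite mul1n; exact: natr_le_pow.
  have h3 : ln p + 1 <= P ^+ (1 * D).
    have := ln_le_sub1 p; rewrite mul1n => h3.
    apply: (@le_trans _ _ P); first by rewrite /P; lra.
    by rewrite -[leLHS]expr1 ler_eXn2l//; lra.
  rewrite -(powD 8 1)%N -(powD 7 1)%N.
  rewrite (_ : 128 * _ = 768 * D%:R * (ln p + 1)); last by ring.
  have : 0 <= 768 :> R by lra.
  move: (768 : R) h1 => k h1 k0.
  by rewrite ler_pM ?mulr_ge0 ?(ler_pM _ _ h1 h2)//; lra.
have ee : 1 <= eps ^- 4.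
  by rewrite -exprVn exprn_ege1// invf_ge1// ltW.
have nn : 1 <= n ^+ 2 by apply: exprn_ege1; lra.
have ln2 : 2^-1 <= ln (n / eps).
  apply: (@le_trans _ _ (ln 2)).
    have := @ln_le_sub1 R 2^-1; rewrite lnV ?posrE//; lra.
  rewrite ler_ln ?posrE ?divr_gt0//; try lra.
  by rewrite ler_pdivlMr//; nra.
have ln8 : 8^-1 <= ln (n / eps) ^+ 3.
  have -> : 8^-1 = 2^-1 ^+ 3 :> R by field.
  by rewrite lerXn2r// nnegrE; lra.
have X : (128 * (n * (6 * D%:R * (ln p + 1))) / eps ^+ 2) ^+ 2
    <= P ^+ (209 * D) * (n ^+ 2 * eps ^- 4).
  have -> : (128 * (n * (6 * D%:R * (ln p + 1))) / eps ^+ 2) ^+ 2 =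
     (128 * (6 * D%:R * (ln p + 1))) ^+ 2 * (n ^+ 2 * eps ^- 4).
    by field; rewrite gt_eqF.
  have Z0 : 0 <= 128 * (6 * D%:R * (ln p + 1)).
    by have := mulr_ge0 (ler0n R D) l0; have := ler0n R D; lra.
  move: (128 * _) AP Z0 => Z AP Z0.
  apply: ler_wpM2r; first by rewrite mulr_ge0// (le_trans ler01).
  apply: (@le_trans _ _ (P ^+ (9 * D) ^+ 2)); first exact: lerXn2r (le_trans Z0 AP) AP.
  by rewrite -exprM ler_eXn2l; [rewrite mulnAC leq_mul2r orbT | lra].
have n1 : 1 <= n ^+ 2 * eps ^- 4 by nra.
have h2 : 2 <= P ^+ (1 * D) by apply: bigc; lra.
have h8 : 8 <= P ^+ (2 * D) by apply: bigc; lra.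
set w := n ^+ 2 * eps ^- 4 in n1 X; set L := ln (n / eps) ^+ 3 in ln8 *.
set Y := (_ / eps ^+ 2) ^+ 2 in X *.
have -> : P ^+ (212 * D) * n ^+ 2 * eps ^- 4 * L
    = P ^+ (2 * D) * (P ^+ (1 * D) * (P ^+ (209 * D) * (w * L))).
  by rewrite -(powD 2 210)%N -(powD 1 209)%N /w; ring.
move: (pow1 (209 * D)%N) X NP16.
set a := P ^+ (209 * D); set b := P ^+ (2 * D) in h8 *; set c := P ^+ (1 * D) in h2 *.
clearbody a b c w L Y; move=> a1 X NP16.
have a0 : 0 <= a by lra.
have aw : a <= a * w by rewrite ler_peMr.
have cw : 2 * (a * w) <= c * (a * w) by rewrite ler_wpM2r// mulr_ge0//; lra.
have bL : 1 <= b * L.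
  have : 8 * 8^-1 <= b * L by rewrite ler_pM// invr_ge0.
  lra.
have : c * (a * w) <= (b * L) * (c * (a * w)) by rewrite ler_peMl// !mulr_ge0//; lra.
rewrite (_ : b * L * (c * (a * w)) = b * (c * (a * (w * L)))); last by ring.
lra.
Qed.

End Budget.

(** * Choice of the constants and of the first fixed-point iteration *)

Theorem theorem2 :
  exists C : nat,
    forall (R : realType) (G : sgraph) (psi : mrf R G) (eps : R),
      (psi_norm psi < +oo)%E -> 0 < eps < 1 ->
      exists T : nat,
        terminates_at psi eps T /\
        T%:R <= Num.max 1
                  ((fine (psi_norm psi) + 2) ^+ (C * max_degree G)
                   * #|G|%:R ^+ 2 * eps ^- 4 * ln (#|G|%:R / eps) ^+ 3).
Proof.
exists 212%N => R G psi eps fin epsP.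
(* Without edges the fixed-point condition is vacuous and iteration 1 terminates, within the lower
   cap 1 of the bound. *)
have [D0|] := posnP (max_degree G).
  exists 1%N; split; last by rewrite le_max lexx.
  split=> // [u v uv|s]; last by case: s.
  have := max_degreeP G u; rewrite D0 leqn0 cards_eq0 => /eqP/setP/(_ v).
  by rewrite nbrE inE uv.
move=> D0; have [u [v uv]] : exists u v : G, adj u v.
  apply: contrapT => none; move: D0; rewrite /max_degree big1// => u _.
  apply/eqP; rewrite cards_eq0; apply/eqP/setP => v; rewrite nbrE inE.
  by apply/negP => uv; apply: none; exists u, v.
have [vP eP] := psi_norm_bounds psi fin.
set p := fine _ in vP eP *.
have p1 : 1 <= p by have [] := vP u true.
have vpotP w a : p^-1 <= vpot psi w a <= p by have [] := vP w a.
have n2 : 2 <= #|G|%:R :> R.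
  rewrite ler_nat; have := cards2 u v.
  have -> : u != v by apply: contraTneq uv => ->; rewrite adj_irrefl.
  by move=> <-; exact: max_card.
(* The exponent makes ln Q = 8 Delta ln (p + 2), which dominates the non-entropic part of every
   slope. *)
pose Q := (p + 2) ^+ (8 * max_degree G).
have P3 : 3 <= p + 2 by lra.
have Q1 : 1 <= Q by apply: exprn_ege1; lra.
pose N := (Num.truncn (100 * Q)).+1.
have Q100 : 0 <= 100 * Q by lra.
have /andP[Nl Nu] := truncn_itv Q100.
pose A : R := #|G|%:R * (6 * (max_degree G)%:R * (ln p + 1)).
pose W := (Num.truncn ((128 * A / eps ^+ 2) ^+ 2)).+1.
have /andP[Wl Wu] := truncn_itv (sqr_ge0 (128 * A / eps ^+ 2)).
have pQ : 8 * (max_degree G)%:R * ln p <= ln Q.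
  rewrite /Q lnXn; last lra.
  rewrite -[leRHS]mulr_natl natrM ler_wpM2l ?mulr_ge0// ler_ln ?posrE; lra.
have DQ : (max_degree G)%:R <= Q.
  apply: le_trans (natr_le_pow (p + 2) _ P3) _; rewrite /Q ler_eXn2l ?leq_pmull//; lra.
have [t /andP[t0 tW] tfix] := bp_fixpoint_reached psi p p1 vpotP eP Q N D0 Q1 pQ DQ
  (ltW Nu) eps A W epsP (fun y yI => bethe_bound psi p p1 vpotP eP y D0 yI) Wu.
(* Termination asks for the first fixed-point iteration, hence the least such index. *)
have ex : exists t, `[< (0 < t)%N /\ approx_bp_fixpoint psi eps (message psi t) >].
  by exists t; apply/asboolP.
exists (ex_minn ex); case: ex_minnP => T /asboolP[T0 Tfix] Tmin; split.
  split=> // s /andP[s0 sT] sfix; move: sT; rewrite ltnNge => /negP; apply.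
  by apply: Tmin; apply/asboolP.
rewrite le_max; apply/orP; right.
have Tt : (T <= t)%N by apply: Tmin; apply/asboolP.
apply: (iteration_budget p _ eps _ N%:R _ D0 p1 n2 epsP) => //.
  by rewrite /N -natr1 lerD2r.
apply: (@le_trans _ _ (2 * N ^ 16 + W)%:R).
  by rewrite ler_nat ltnW// (leq_ltn_trans Tt).
by rewrite natrD natrM natrX lerD2l /W -natr1 lerD2r.
Qed.
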